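(* Let $t = t(n)$. If there is an algorithm (data structure) that solves the dynamic pointer following problem on $n$ nodes in $O(t)$ time per operation, then there is an algorithm that solves the path dynamic connectivity problem on $n$ nodes in $O(t)$ time per operation.
   Context: Dynamic pointer following problem on nodes $\{1,\dots,n\}$: each node $v$ has a pointer to a node $f(v)\in\{1,\dots,n\}$ (possibly $v$ itself); the operations are Update$(v,w)$, which sets $f(v):=w$, and Query$(v,k)$, which returns the $k$-th iterate $f^{k}(v)$. Dynamic connectivity problem on a set of $n$ nodes: support (i) adding a (possibly directed) edge between two nodes, (ii) deleting an existing edge between two nodes, (iii) querying whether two nodes $v,w$ belong to the same connected component. Path dynamic connectivity is the same problem under the guarantee that, at all times, every connected component of the graph is a directed path. The path dynamic connectivity instance starts with no edges. *)

(* Defs.v *)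
From mathcomp Require Import all_boot all_order all_algebra.
From mathcomp Require Import all_classical all_reals.
From mathcomp Require Import topology normedtype landau.

Set Implicit Arguments.
Unset Strict Implicit.
Unset Printing Implicit Defensive.

Import GRing.Theory Num.Theory numFieldNormedType.Exports.

(* * Word RAM

   Deterministic word RAM with words of [w] bits, programmed in a structured
   language.  A program mentions finitely many registers; the memory cells are
   addressed by words.  Words are represented by naturals below [2 ^ w], and
   every instruction reduces its result modulo [2 ^ w]. *)

Record machine := Machine { regs : nat -> nat; mem : nat -> nat }.

Definition set_reg (s : machine) (d x : nat) : machine :=
  Machine [eta regs s with d |-> x] (mem s).

Definition set_mem (s : machine) (a x : nat) : machine :=
  Machine (regs s) [eta mem s with a |-> x].

Inductive binop :=
  | BAdd | BSub | BMul | BDiv | BMod | BAnd | BOr | BXor | BShl | BShr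
  | BEq | BLt.

Definition eval_binop (w : nat) (o : binop) (x y : nat) : nat :=
  (match o with
   | BAdd => x + y
   | BSub => x + 2 ^ w - y
   | BMul => x * y
   | BDiv => x %/ y
   | BMod => x %% y
   | BAnd => Nat.land x y
   | BOr => Nat.lor x y
   | BXor => Nat.lxor x y
   | BShl => x * 2 ^ y
   | BShr => x %/ 2 ^ y
   | BEq => x == y
   | BLt => x < y
   end) %% 2 ^ w.

Inductive program :=
  | Skip
  | Const (d c : nat)
  | Move (d a : nat)
  | Binop (o : binop) (d a b : nat)
  | Fetch (d a : nat)
  | Store (a b : nat)
  | Seq (p q : program)
  | If (a : nat) (p q : program)
  | While (a : nat) (p : program).

(* [exec w p s s' c]: started in [s], the program [p] halts in [s'] after [c]
   steps.  Every instruction (including [Skip]) and every evaluation of a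
   branch or loop condition is one step. *)
Inductive exec (w : nat) : program -> machine -> machine -> nat -> Prop :=
  | ESkip s : exec w Skip s s 1
  | EConst s d c : exec w (Const d c) s (set_reg s d (c %% 2 ^ w)) 1
  | EMove s d a : exec w (Move d a) s (set_reg s d (regs s a)) 1
  | EBinop s o d a b :
      exec w (Binop o d a b) s
        (set_reg s d (eval_binop w o (regs s a) (regs s b))) 1
  | EFetch s d a : exec w (Fetch d a) s (set_reg s d (mem s (regs s a))) 1
  | EStore s a b : exec w (Store a b) s (set_mem s (regs s a) (regs s b)) 1
  | ESeq p q s1 s2 s3 c1 c2 :
      exec w p s1 s2 c1 -> exec w q s2 s3 c2 ->
      exec w (Seq p q) s1 s3 (c1 + c2)
  | EIfTrue a p q s s' c :
      regs s a <> 0 -> exec w p s s' c -> exec w (If a p q) s s' c.+1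
  | EIfFalse a p q s s' c :
      regs s a = 0 -> exec w q s s' c -> exec w (If a p q) s s' c.+1
  | EWhileDone a p s : regs s a = 0 -> exec w (While a p) s s 1
  | EWhileStep a p s1 s2 s3 c1 c2 :
      regs s1 a <> 0 -> exec w p s1 s2 c1 -> exec w (While a p) s2 s3 c2 ->
      exec w (While a p) s1 s3 (c1 + c2).+1.

(* * Dynamic problems and data structures *)

(* [op] lists the operations of the problem; a request of size [n] is an
   operation [kind] together with its two arguments, encoded as words by
   [args].  Requests that are not [legal] in the current configuration are
   never issued; an operation without output has answer [None]. *)
Record dynamic_problem := DynamicProblem {
  op : Type;
  config : nat -> Type;
  request : nat -> Type;
  start : forall n, config n;
  kind : forall n, request n -> op;
  args : forall n, request n -> nat * nat;
  legal : forall n, config n -> request n -> Prop;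
  next : forall n, config n -> request n -> config n;
  answer : forall n, config n -> request n -> option nat
}.

(* The programs do not depend on [n]: the preprocessing program [setup] finds
   [n] in register 0. *)
Record data_structure (O : Type) := DataStructure {
  setup : program;
  proc : O -> program
}.

Definition boot (n : nat) : machine :=
  set_reg (Machine (fun=> 0) (fun=> 0)) 0 n.

(* Registers and memory persist from one operation to the next; the arguments
   are passed in registers 0 and 1, and the answer is returned in register 0. *)
Definition pass_args (s : machine) (xy : nat * nat) : machine :=
  set_reg (set_reg s 0 xy.1) 1 xy.2.

(* Starting from machine state [s], which stands for the configuration [x], the
   legal requests of the sequence [rs] are served online, each one correctly
   and in at most [T] steps. *)
Fixpoint serves (R : numDomainType) (P : dynamic_problem)
    (D : data_structure (op P)) (w n : nat) (T : R)
    (s : machine) (x : config P n) (rs : seq (request P n)) : Prop :=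
  if rs is r :: rs' then
    legal x r -> (args r).1 < 2 ^ w -> (args r).2 < 2 ^ w ->
    exists s' c,
      [/\ exec w (proc D (kind r)) (pass_args s (args r)) s' c,
          (c%:R <= T)%R,
          forall y, answer x r = Some y -> regs s' 0 = y
        & serves D w T s' (next x r) rs']
  else True.

Definition solves (R : numDomainType) (P : dynamic_problem)
    (w : nat -> nat) (D : data_structure (op P)) (T : nat -> R) : Prop :=
  forall n : nat, exists s0 c,
    exec (w n) (setup D) (boot n) s0 c /\
    forall rs : seq (request P n), serves D (w n) (T n) s0 (start P n) rs.

(* Worst-case time O(t) per operation on a word RAM with [w n]-bit words; the
   preprocessing has to halt but is not charged. *)
Definition solvable_in_time (R : realType) (P : dynamic_problem)
    (w : nat -> nat) (t : nat -> R) : Prop :=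
  exists (D : data_structure (op P)) (T : nat -> R),
    solves w D T /\ (T =O_\oo t)%classic.

(* The nodes are the elements of ['I_n]; node [i] is passed to and returned by
   programs as the word [i.+1], so that programs see the nodes 1, ..., n. *)
Definition node_word (n : nat) (i : 'I_n) : nat := i.+1.

(* * Dynamic pointer following *)

Inductive pointer_op := OpUpdate | OpPointerQuery.

Inductive pointer_request (n : nat) :=
  | Update (v w : 'I_n)
  | PointerQuery (v : 'I_n) (k : nat).

Definition pointer_kind (n : nat) (r : pointer_request n) : pointer_op :=
  match r with
  | Update _ _ => OpUpdate
  | PointerQuery _ _ => OpPointerQuery
  end.

Definition pointer_args (n : nat) (r : pointer_request n) : nat * nat :=
  match r with
  | Update v w => (node_word v, node_word w)
  | PointerQuery v k => (node_word v, k)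
  end.

Definition pointer_next (n : nat) (f : {ffun 'I_n -> 'I_n})
    (r : pointer_request n) : {ffun 'I_n -> 'I_n} :=
  match r with
  | Update v w => [ffun u => if u == v then w else f u]
  | PointerQuery _ _ => f
  end.

Definition pointer_answer (n : nat) (f : {ffun 'I_n -> 'I_n})
    (r : pointer_request n) : option nat :=
  match r with
  | Update _ _ => None
  | PointerQuery v k => Some (node_word (iter k f v))
  end.

(* [f0 n] is the pointer function on [n] nodes before the first operation. *)
Definition pointer_following (f0 : forall n, {ffun 'I_n -> 'I_n}) :
    dynamic_problem :=
  {| op := pointer_op;
     config := fun n => {ffun 'I_n -> 'I_n};
     request := pointer_request;
     start := f0;
     kind := pointer_kind;
     args := pointer_args;
     legal := fun n _ _ => True;
     next := pointer_next;
     answer := pointer_answer |}.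

(* * Path dynamic connectivity *)

(* A directed graph on [V] is its set of edges, [(v, w)] being the edge from
   [v] to [w]; components ignore the directions. *)
Definition adjacent (V : finType) (E : {set V * V}) : rel V :=
  fun v w => ((v, w) \in E) || ((w, v) \in E).

Definition component (V : finType) (E : {set V * V}) (v : V) : {set V} :=
  [set w | connect (adjacent E) v w].

(* The subgraph induced on [A] is a directed path, visiting the nodes in the
   order of [p]. *)
Definition directed_path (V : finType) (E : {set V * V}) (A : {set V}) : Prop :=
  exists p : seq V,
    [/\ uniq p,
        A =i p
      & {in A &, forall v w, ((v, w) \in E) = ((v, w) \in zip p (behead p))}].

Definition path_components (V : finType) (E : {set V * V}) : Prop :=
  forall v : V, directed_path E (component E v).

Inductive connectivity_op := OpAddEdge | OpDelEdge | OpConnected.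

Inductive connectivity_request (n : nat) :=
  | AddEdge (v w : 'I_n)
  | DelEdge (v w : 'I_n)
  | Connected (v w : 'I_n).

Definition connectivity_kind (n : nat) (r : connectivity_request n) :
    connectivity_op :=
  match r with
  | AddEdge _ _ => OpAddEdge
  | DelEdge _ _ => OpDelEdge
  | Connected _ _ => OpConnected
  end.

Definition connectivity_args (n : nat) (r : connectivity_request n) :
    nat * nat :=
  match r with
  | AddEdge v w | DelEdge v w | Connected v w => (node_word v, node_word w)
  end.

Definition connectivity_next (n : nat) (E : {set 'I_n * 'I_n})
    (r : connectivity_request n) : {set 'I_n * 'I_n} :=
  match r with
  | AddEdge v w => (v, w) |: E
  | DelEdge v w => E :\ (v, w)
  | Connected _ _ => E
  end.

(* Only an existing edge is deleted, and all components remain directed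
   paths. *)
Definition path_connectivity_legal (n : nat) (E : {set 'I_n * 'I_n})
    (r : connectivity_request n) : Prop :=
  (forall v w, r = DelEdge v w -> (v, w) \in E) /\
  path_components (connectivity_next E r).

Definition connectivity_answer (n : nat) (E : {set 'I_n * 'I_n})
    (r : connectivity_request n) : option nat :=
  match r with
  | AddEdge _ _ | DelEdge _ _ => None
  | Connected v w => Some (nat_of_bool (w \in component E v))
  end.

Definition path_connectivity : dynamic_problem :=
  {| op := connectivity_op;
     config := fun n => {set 'I_n * 'I_n};
     request := connectivity_request;
     start := fun n => finset.set0;
     kind := connectivity_kind;
     args := connectivity_args;
     legal := path_connectivity_legal;
     next := connectivity_next;
     answer := connectivity_answer |}.

(* Main.v *)
(* The pointer of each node is its successor on its path, or the node itself if
   it has none; adding or deleting an edge is then one update.  After n steps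
   every node of a path has reached the last one, so v and w are connected iff
   the n-th iterates of v and w coincide.  The preprocessing redirects all the
   pointers of f0 to self-loops.  The constant overhead is absorbed in O(t)
   because every operation takes at least one step. *)

From mathcomp Require Import all_boot all_reals.
From mathcomp Require Import all_order all_algebra.
From mathcomp Require Import zify lra.
From mathcomp Require Import all_classical topology normedtype landau.
Require Import Defs.

Set Implicit Arguments.
Unset Strict Implicit.
Unset Printing Implicit Defensive.

Import Order.TTheory GRing.Theory Num.Theory numFieldNormedType.Exports.

(** * Determinism and locality of word RAM programs *)

Lemma exec_det w p s s1 s2 c1 c2 :
  exec w p s s1 c1 -> exec w p s s2 c2 -> s1 = s2.
Proof.
move=> e1; elim: e1 s2 c2 => {p s s1 c1}
  [s|s d c|s d a|s o d a b|s d a|s a b|p q s1 s2 s3 c1 c2 _ IHp _ IHq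
  |a p q s s' c ha _ IH|a p q s s' c ha _ IH|a p s ha
  |a p s1 s2 s3 c1 c2 ha _ IHp _ IHw] s4 c4 e; inversion e; subst=> //.
- match goal with H : exec w p s1 _ _ |- _ => have e2 := IHp _ _ H end.
  by subst; eauto.
- by eauto.
- by eauto.
- match goal with H : exec w p s1 _ _ |- _ => have e2 := IHp _ _ H end.
  by subst; eauto.
Qed.

Lemma exec_gt0 w p s s' c : exec w p s s' c -> 0 < c.
Proof. by elim=> // *; rewrite addn_gt0; apply/orP; left. Qed.

Fixpoint reg_bound (p : program) : nat :=
  match p with
  | Skip => 0
  | Const d _ => d.+1
  | Move d a | Fetch d a | Store d a => maxn d.+1 a.+1
  | Binop _ d a b => maxn d.+1 (maxn a.+1 b.+1)
  | Seq p q => maxn (reg_bound p) (reg_bound q)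
  | If a p q => maxn a.+1 (maxn (reg_bound p) (reg_bound q))
  | While a p => maxn a.+1 (reg_bound p)
  end.

(** Registers are compared only on [A], memory in full: the reduction adds registers of its own to
    those of [D], and touches memory only by running [D]. *)
Definition agree (A : pred nat) (s u : machine) : Prop :=
  (forall i, A i -> regs s i = regs u i) /\ mem s = mem u.

Lemma agree_set_reg A s u d x : agree A s u ->
  agree A (set_reg s d x) (set_reg u d x).
Proof. by move=> [Hr Hm]; split=> //= i Ai /=; rewrite Hr. Qed.

Lemma set_reg_eq s d x : regs (set_reg s d x) d = x.
Proof. by rewrite /= eqxx. Qed.

Lemma set_reg_neq s d x i : i != d -> regs (set_reg s d x) i = regs s i.
Proof. by move=> /= /negbTE ->. Qed.

(** A program reads and writes no register outside its bound, so two states that agree below [M] run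
    in lockstep at equal cost. This lets the reduction keep its own data at indices from [M] on
    while it runs the code of [D]. *)
Lemma exec_agree w M p s s' c u :
  exec w p s s' c -> reg_bound p <= M -> agree (gtn M) s u ->
  exists u', [/\ exec w p u u' c, agree (gtn M) s' u'
               & forall i, M <= i -> regs u' i = regs u i].
Proof.
move=> e; elim: e u => {p s s' c}
  [s|s d c|s d a|s o d a b|s d a|s a b|p q s1 s2 s3 c1 c2 _ IHp _ IHq
  |a p q s s' c ha _ IH|a p q s s' c ha _ IH|a p s ha
  |a p s1 s2 s3 c1 c2 ha _ IHp _ IHw] u /=; rewrite ?geq_max => le su;
  have [sur sum] := su.
- by exists u; split=> //; exact: ESkip.
- exists (set_reg u d (c %% 2 ^ w)); split; first exact: EConst.
    exact: agree_set_reg.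
  by move=> i Mi; apply: set_reg_neq; rewrite gtn_eqF // (leq_trans _ Mi).
- move: le => /andP[dM aM].
  exists (set_reg u d (regs u a)); split; first exact: EMove.
    by rewrite sur //; exact: agree_set_reg.
  by move=> i Mi; apply: set_reg_neq; rewrite gtn_eqF // (leq_trans _ Mi).
- move: le => /and3P[dM aM bM].
  exists (set_reg u d (eval_binop w o (regs u a) (regs u b))); split; first exact: EBinop.
    by rewrite !sur //; exact: agree_set_reg.
  by move=> i Mi; apply: set_reg_neq; rewrite gtn_eqF // (leq_trans _ Mi).
- move: le => /andP[dM aM].
  exists (set_reg u d (mem u (regs u a))); split; first exact: EFetch.
    by rewrite sur // sum; exact: agree_set_reg.
  by move=> i Mi; apply: set_reg_neq; rewrite gtn_eqF // (leq_trans _ Mi).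
- move: le => /andP[aM bM].
  exists (set_mem u (regs u a) (regs u b)); split=> //; first exact: EStore.
  by split=> [i Mi|] /=; rewrite ?sum ?(sur a) ?(sur b) ?(sur i).
- move: le => /andP[pM qM].
  have [u2 [e2 su2 h2]] := IHp _ pM su.
  have [u3 [e3 su3 h3]] := IHq _ qM su2.
  exists u3; split=> //; first exact: ESeq e2 e3.
  by move=> i Mi; rewrite h3 // h2.
- move: le => /and3P[aM pM qM].
  have [u' [e' su' h']] := IH _ pM su.
  by exists u'; split=> //; apply: EIfTrue e'; rewrite -sur.
- move: le => /and3P[aM pM qM].
  have [u' [e' su' h']] := IH _ qM su.
  by exists u'; split=> //; apply: EIfFalse e'; rewrite -sur.
- move: le => /andP[aM pM].
  by exists u; split=> //; apply: EWhileDone; rewrite -sur.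
- move: (le) => /andP[aM pM].
  have [u2 [e2 su2 h2]] := IHp _ pM su.
  have [||u3 [e3 su3 h3]] := IHw u2; rewrite /= ?geq_max //.
  exists u3; split=> //; first by apply: EWhileStep e2 e3; rewrite -sur.
  by move=> i Mi; rewrite h3 // h2.
Qed.

(** * Running a data structure from inside another program *)

Section Serving.
Variables (R : numDomainType) (P : dynamic_problem) (D : data_structure (op P)).
Variables (w n : nat) (T : R).

(** Quantifying over all sequences gives an invariant of the state alone, so one connectivity
    request may be turned into several pointer requests. *)
Definition serves_all (s : machine) (x : config P n) : Prop :=
  forall rs : seq (request P n), serves D w T s x rs.

(* Determinism makes the state reached after [r] independent of the requests
   that follow. *)
Lemma serves_all_step s x (r : request P n) :
  serves_all s x -> legal x r -> (args r).1 < 2 ^ w -> (args r).2 < 2 ^ w ->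
  exists s' c,
    [/\ exec w (proc D (kind r)) (pass_args s (args r)) s' c,
        (c%:R <= T)%R,
        forall y, answer x r = Some y -> regs s' 0 = y
      & serves_all s' (next x r)].
Proof.
move=> Hs Hl H1 H2.
have [s' [c [e cT ans _]]] := Hs [:: r] Hl H1 H2.
exists s', c; split=> // rs.
have [s2 [c2 [e2 _ _ Hrs]]] := Hs (r :: rs) Hl H1 H2.
by rewrite (exec_det e e2).
Qed.

(** Here [s] is a state of [D] running by itself and [u] the state of the enclosing program. They
    may differ on registers 0 and 1, since [pass_args] overwrites both in [s]; [exec_agree] then
    transfers the run to [u]. *)
Lemma serves_all_call M s x u (r : request P n) :
  0 < M -> reg_bound (proc D (kind r)) <= M ->
  serves_all s x -> legal x r -> (args r).1 < 2 ^ w -> (args r).2 < 2 ^ w ->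
  regs u 0 = (args r).1 -> regs u 1 = (args r).2 ->
  agree [pred i | 1 < i < M] s u ->
  exists s' u' c,
    [/\ exec w (proc D (kind r)) u u' c, (c%:R <= T)%R,
        forall y, answer x r = Some y -> regs u' 0 = y,
        serves_all s' (next x r)
      & agree (gtn M) s' u' /\ forall i, M <= i -> regs u' i = regs u i].
Proof.
move=> M0 pM Hs Hl H1 H2 u0 u1 [sur sum].
have [s' [c [e cT ans Hs']]] := serves_all_step Hs Hl H1 H2.
have su : agree (gtn M) (pass_args s (args r)) u.
  split=> // -[|[|i]] iM //=; apply: sur.
  by rewrite inE.
have [u' [e' su' h']] := exec_agree e pM su.
exists s', u', c; split=> // y /ans <-.
by rewrite su'.1.
Qed.

End Serving.

(** * Directed paths and iterated successor pointers *)

Section Paths.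
Variables (V : finType) (E : {set V * V}).

Lemma mem_zip_behead (p : seq V) (x0 a b : V) :
  reflect (exists2 i, i.+1 < size p & a = nth x0 p i /\ b = nth x0 p i.+1)
          ((a, b) \in zip p (behead p)).
Proof.
apply: (iffP (nthP (x0, x0))) => [[i]|[i ip [-> ->]]].
  rewrite size_zip size_behead nth_zip_cond size_zip size_behead => lti.
  rewrite lti => -[<- <-]; exists i; last by rewrite nth_behead.
  by move: lti; rewrite leq_min; case: (size p) i => [|m] i /andP[].
have lti : i < size (zip p (behead p)).
  by rewrite size_zip size_behead leq_min; case: (size p) ip => // m; rewrite ltnS => H; rewrite H ltnS ltnW.
by exists i => //; rewrite nth_zip_cond lti nth_behead.
Qed.

Lemma adjacent_sym : symmetric (adjacent E).
Proof. by move=> x y; rewrite /adjacent orbC. Qed.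

Lemma edge_component v a b : a \in component E v -> (a, b) \in E ->
  b \in component E v.
Proof.
rewrite !inE => va ab; apply: connect_trans va (connect1 _).
by rewrite /adjacent ab.
Qed.

(** Both edges lie in the component of [v], so each joins consecutive positions of its path; as the
    path repeats no node, [v] has a single position and hence a single successor. *)
Lemma path_components_functional v a b : path_components E ->
  (v, a) \in E -> (v, b) \in E -> a = b.
Proof.
move=> /(_ v)[p [up Ap Ep]] va vb.
have vv : v \in component E v by rewrite inE.
have av := edge_component vv va; have bv := edge_component vv vb.
move: va vb; rewrite !Ep // => /(mem_zip_behead _ v)[i ip [vi ->]].
move=> /(mem_zip_behead _ v)[j jp [vj ->]].
suff -> : i = j by [].
by apply/eqP; rewrite -(nth_uniq v (ltnW ip) (ltnW jp) up) -vi -vj.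
Qed.

Definition follows (f : V -> V) : Prop :=
  (forall v w, (v, w) \in E -> f v = w) /\
  (forall v, (forall w, (v, w) \notin E) -> f v = v).

Lemma follows_edge f v : follows f -> f v = v \/ (v, f v) \in E.
Proof.
move=> [f1 f2]; have [/existsP[w vw]|] := boolP [exists w, (v, w) \in E].
  by right; rewrite (f1 _ _ vw).
by rewrite negb_exists => /forallP/f2; left.
Qed.

Lemma follows_connect f k v : follows f -> connect (adjacent E) v (iter k f v).
Proof.
move=> Hf; elim: k => //= k IH; apply: connect_trans IH _.
set u := iter k f v.
case: (follows_edge u Hf) => [->//|uE].
by apply: connect1; rewrite /adjacent uE.
Qed.

(** One application of [f] advances by one position and is stationary at the last one, so positions
    add up and are capped at [(size p).-1]. *)
Lemma follows_iter f v p : follows f -> uniq p -> component E v =i p ->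
  {in component E v &,
    forall a b, ((a, b) \in E) = ((a, b) \in zip p (behead p))} ->
  forall j k, j < size p ->
  iter k f (nth v p j) = nth v p (minn (j + k) (size p).-1).
Proof.
move=> [f1 f2] up Ap Ep.
have step j : j < size p -> f (nth v p j) = nth v p (minn j.+1 (size p).-1).
  move=> jp; have jC : nth v p j \in component E v by rewrite Ap mem_nth.
  have [j1|j1] := ltnP j.+1 (size p).
    have -> : minn j.+1 (size p).-1 = j.+1.
      by apply/minn_idPl; case: (size p) j1.
    apply: f1; rewrite Ep ?Ap ?mem_nth //.
    by apply/(mem_zip_behead _ v); exists j.
  have sp : size p = j.+1 by apply/eqP; rewrite eqn_leq j1 jp.
  (* An edge out of the last node would end in the same component, hence join positions [i] and
     [i.+1] of [p] with [i = j], beyond the end. *)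
  rewrite sp /= (minn_idPr (leqnSn j)); apply: f2 => u; apply/negP => uE.
  move: (uE); rewrite Ep //; last exact: edge_component uE.
  move=> /(mem_zip_behead _ v)[i ip [/eqP ji _]].
  by rewrite nth_uniq // 1?ltnW // in ji; rewrite -(eqP ji) sp ltnn in ip.
move=> j k jp; elim: k => [|k IH] /=.
  by rewrite addn0 (minn_idPl _) //; case: (size p) jp.
have lt : minn (j + k) (size p).-1 < size p.
  by apply: (@leq_ltn_trans (size p).-1); rewrite ?geq_minr // ltn_predL (leq_ltn_trans _ jp).
rewrite IH step // addnS; congr (nth v p _).
by move: (size p) jp => m _; lia.
Qed.

(** A path has at most [#|V|] nodes, so [n] steps reach the cap of [follows_iter] from any position.
    Conversely, each node is connected to its iterates, so a common iterate joins [u] and [v]. *)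
Lemma connected_iterE f v u n : path_components E -> follows f -> #|V| <= n ->
  (u \in component E v) = (iter n f v == iter n f u).
Proof.
move=> HE Hf Vn; have [p [up Ap Ep]] := HE v.
have pn : size p <= n by rewrite -(card_uniqP up) (leq_trans (max_card _)).
apply/idP/eqP => [uv|e].
  have H x : x \in component E v -> iter n f x = nth v p (size p).-1.
    rewrite Ap => xp; rewrite -{1}(nth_index v xp).
    rewrite (follows_iter Hf up Ap Ep) ?index_mem //; congr nth.
    apply/minn_idPr; apply: leq_trans (leq_addl _ _); exact: leq_trans (leq_pred _) pn.
  by rewrite !H // inE.
rewrite inE; apply: connect_trans (follows_connect n _ Hf) _; rewrite e.
by rewrite (sym_connect_sym adjacent_sym) follows_connect.
Qed.

End Paths.

(** * The reduction and its simulation invariant *)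

Section Reduction.
Variables (f0 : forall n, {ffun 'I_n -> 'I_n}).
Variable D : data_structure (op (pointer_following f0)).

(** First register free for the reduction: above everything [D] mentions, and at least 2 so that the
    argument registers stay below it. *)
Definition spare : nat :=
  maxn 2 (maxn (reg_bound (setup D))
    (maxn (reg_bound (proc D OpUpdate)) (reg_bound (proc D OpPointerQuery)))).

(* Beyond the registers of [D]: [spare] holds a loop counter or a saved argument,
   [spare.+1] the number of nodes, [spare.+2] the constant 1 or the first
   answer. *)
Definition reset_body : program :=
  Seq (Move 0 spare) (Seq (Move 1 spare)
    (Seq (proc D OpUpdate) (Binop BSub spare spare spare.+2))).

(** The size is first copied out of register 0, which [setup D] may overwrite. The loop counter then
    runs from [n] down to 1, that is, through the node words. *)
Definition path_setup : program :=
  Seq (Move spare.+1 0) (Seq (setup D)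
    (Seq (Const spare.+2 1) (Seq (Move spare spare.+1)
      (While spare reset_body)))).

(** For a deletion, copying register 0 to register 1 turns the update into a self-loop at the tail
    of the edge. For a query, the second argument and the first answer are parked beyond the
    registers of [D], because a call may overwrite registers 0 and 1. *)
Definition path_proc (o : connectivity_op) : program :=
  match o with
  | OpAddEdge => proc D OpUpdate
  | OpDelEdge => Seq (Move 1 0) (proc D OpUpdate)
  | OpConnected =>
      Seq (Move spare 1) (Seq (Move 1 spare.+1)
        (Seq (proc D OpPointerQuery)
          (Seq (Move spare.+2 0) (Seq (Move 0 spare) (Seq (Move 1 spare.+1)
            (Seq (proc D OpPointerQuery) (Binop BEq 0 0 spare.+2)))))))
  end.

Definition path_structure : data_structure (op path_connectivity) :=
  @DataStructure (op path_connectivity) path_setup path_proc.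

Variables (R : realDomainType) (w n : nat) (T : R).
Hypothesis nw : n < 2 ^ w.

(** The witness [s] is a state from which [D] alone serves the pointers [f]. Registers 0 and 1 and
    those from [spare] on are left free in [u], except for the stored [n]. *)
Definition simulates (u : machine) (f : {ffun 'I_n -> 'I_n}) : Prop :=
  exists s, [/\ @serves_all R (pointer_following f0) D w n T s f,
                agree [pred i | 1 < i < spare] s u & regs u spare.+1 = n].

Lemma spare_gt1 : 1 < spare. Proof. by rewrite leq_max. Qed.

Lemma reg_bound_setup : reg_bound (setup D) <= spare.
Proof. by rewrite /spare !leq_max leqnn !orbT. Qed.

Lemma reg_bound_proc o : reg_bound (proc D o) <= spare.
Proof. by case: o; rewrite /spare !leq_max leqnn !orbT. Qed.

Lemma set_reg_simulates u f d x : (d < 2) || (spare <= d) -> d != spare.+1 ->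
  simulates u f -> simulates (set_reg u d x) f.
Proof.
move=> dr dn [s [Hs [Hr Hm] un]]; exists s; split=> //=.
  split=> // i /= Ai; rewrite (Hr _ Ai); case: eqP => // e; subst i.
  by move: Ai dr; lia.
by rewrite eq_sym (negbTE dn).
Qed.

Lemma pass_args_simulates u f xy : simulates u f -> simulates (pass_args u xy) f.
Proof.
have sp1 := spare_gt1.
by move=> Hu; do 2![apply: set_reg_simulates; [by []|lia|]].
Qed.

Lemma simulates_call u f (r : pointer_request n) :
  simulates u f -> (pointer_args r).1 < 2 ^ w -> (pointer_args r).2 < 2 ^ w ->
  regs u 0 = (pointer_args r).1 -> regs u 1 = (pointer_args r).2 ->
  exists u' c,
    [/\ exec w (proc D (pointer_kind r)) u u' c, (c%:R <= T)%R,
        forall y, pointer_answer f r = Some y -> regs u' 0 = y,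
        simulates u' (pointer_next f r)
      & forall i, spare <= i -> regs u' i = regs u i].
Proof.
move=> [s [Hs su un]] H1 H2 u0 u1.
have [s' [u' [c [e cT ans Hs' [su' hu']]]]] :=
  @serves_all_call R (pointer_following f0) D w n T spare s f u r
    (ltnW spare_gt1) (reg_bound_proc _) Hs I H1 H2 u0 u1 su.
exists u', c; split=> //; exists s'; split=> //; last by rewrite hu'.
by case: su' => Hr Hm; split=> // i; rewrite inE => /andP[_ ?]; apply: Hr.
Qed.

Lemma node_word_lt (i : 'I_n) : node_word i < 2 ^ w.
Proof. exact: leq_ltn_trans (ltn_ord i) nw. Qed.

(** Loop invariant: the nodes of index at least [k] already point to themselves. The constant 1 is
    stored as [1 %% 2 ^ w], since for [n = 0] words may have zero bits. *)
Lemma reset_loop k u f :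
  k <= n -> simulates u f -> regs u spare = k -> regs u spare.+2 = 1 %% 2 ^ w ->
  (forall i : 'I_n, k <= i -> f i = i) ->
  exists u' c, exec w (While spare reset_body) u u' c /\ simulates u' [ffun i => i].
Proof.
elim: k u f => [|k IH] u f kn Hu uk u1 fk.
  exists u, 1; split; first exact: EWhileDone.
  by have -> : [ffun i => i] = f by apply/ffunP=> i; rewrite ffunE fk.
(* Node words are shifted by one, so the counter value [k.+1] is the word of the node of index
   [k]. *)
pose i := Ordinal kn.
pose ua := pass_args u (k.+1, k.+1).
have Hua : simulates ua f by exact: pass_args_simulates.
have [u' [c [e _ _ Hu' hu']]] :=
  @simulates_call ua f (Update i i) Hua (node_word_lt i) (node_word_lt i) erefl erefl.
have sp1 := spare_gt1.
have h0 : regs u' spare = k.+1.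
  by rewrite hu' ?set_reg_neq //; lia.
have h2 : regs u' spare.+2 = 1 %% 2 ^ w.
  by rewrite hu' ?set_reg_neq //; lia.
pose ub := set_reg u' spare k.
have [|||||u'' [c' [e' Hu'']]] := IH ub (pointer_next f (Update i i)).
- exact: ltnW.
- by apply: set_reg_simulates => //; lia.
- by rewrite /= eqxx.
- by rewrite /= gtn_eqF.
- move=> j; rewrite leq_eqVlt => /predU1P[kj|kj]; rewrite /= ffunE.
    by rewrite -(inj_eq val_inj) /= kj eqxx; apply: val_inj.
  by rewrite -(inj_eq val_inj) /= gtn_eqF // fk.
exists u'', (1 + (1 + (c + 1)) + c').+1; split=> //.
apply: EWhileStep e'; first by rewrite uk.
have m0 := EMove w u 0 spare; rewrite uk in m0.
have m1 := EMove w (set_reg u 0 k.+1) 1 spare.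
rewrite set_reg_neq ?uk in m1; last by lia.
apply: ESeq m0 (ESeq m1 (ESeq e _)).
have m4 := EBinop w u' BSub spare spare spare.+2.
rewrite h0 h2 in m4.
have kw := leq_ltn_trans kn nw.
suff sub1 : eval_binop w BSub k.+1 (1 %% 2 ^ w) = k by rewrite sub1 in m4.
(* By [kw] the stored constant is really 1, and the [2 ^ w] added by [BSub] vanishes modulo
   [2 ^ w]. *)
rewrite /eval_binop (@modn_small 1) ?(leq_trans _ kw) //.
by rewrite addSn subn1 /= modnDr modn_small // ltnW.
Qed.

Lemma path_setup_correct s0 c0 :
  exec w (setup D) (boot n) s0 c0 ->
  @serves_all R (pointer_following f0) D w n T s0 (f0 n) ->
  exists u c, exec w path_setup (boot n) u c /\ simulates u [ffun i => i].
Proof.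
move=> e0 H0.
have b0 : agree (gtn spare) (boot n) (set_reg (boot n) spare.+1 n).
  by split=> // i ilt; rewrite set_reg_neq //; move: ilt => /=; lia.
have [u1 [e1 [su1 mu1] hu1]] := exec_agree e0 reg_bound_setup b0.
have Hu1 : simulates u1 (f0 n).
  exists s0; split=> //; last by rewrite hu1 //= eqxx.
  by split=> // i /andP[_]; apply: su1.
pose u2 := set_reg u1 spare.+2 (1 %% 2 ^ w).
pose u3 := set_reg u2 spare n.
have Hu3 : simulates u3 (f0 n).
  apply: set_reg_simulates; [lia|lia|].
  by apply: set_reg_simulates => //; lia.
have [||i ni|u [c [e Hu]]] := reset_loop (leqnn n) Hu3.
- exact: set_reg_eq.
- by rewrite set_reg_neq ?set_reg_eq //; lia.
- by move: (ltn_ord i); rewrite ltnNge ni.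
exists u, (1 + (c0 + (1 + (1 + c)))); split=> //.
have m0 := EMove w (boot n) spare.+1 0.
apply: ESeq m0 (ESeq e1 (ESeq (EConst w _ _ _) (ESeq _ e))).
have := EMove w u2 spare spare.+1.
by have -> : regs u2 spare.+1 = n by rewrite set_reg_neq ?hu1 ?set_reg_eq //; lia.
Qed.

(** The factor 8 comes from the connectivity query: two calls of cost at most [T] and six further
    instructions, with [1 <= T] because a call takes at least one step. The pointers follow the
    edges throughout. *)
Lemma path_serves u (f : {ffun 'I_n -> 'I_n}) (E : {set 'I_n * 'I_n}) rs :
  simulates u f -> follows E f ->
  @serves R path_connectivity path_structure w n (8%:R * T)%R u E rs.
Proof.
elim: rs u f E => //= r rs IH u f E Hu Hf Hl _ _.
have Hu01 x y : simulates (set_reg (set_reg u 0 x) 1 y) f.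
  exact: (pass_args_simulates (x, y)).
case: r Hl => [a b|a b|a b] /= [Hdel HE].
- have [u' [c [e cT _ Hu' _]]] :=
    @simulates_call _ f (Update a b) (Hu01 (node_word a) (node_word b))
      (node_word_lt a) (node_word_lt b) erefl erefl.
  exists u', c; split=> //.
    have c0 := exec_gt0 e.
    by rewrite -(ler1n R) in c0; lra.
  apply: IH Hu' _; split=> [v w'|v Hv]; rewrite ffunE.
    case: eqP => [->|nva].
      (* The graph after the addition still consists of paths, so [(a, b)] is its only edge out of
         [a]. *)
      by apply: (path_components_functional (v := a) HE); rewrite setU11.
    rewrite !inE xpair_eqE; case: eqP => //= _; exact: Hf.1.
  case: eqP => [va|_].
    by have := Hv b; rewrite va !inE eqxx.
  by apply: Hf.2 => w'; have := Hv w'; rewrite !inE negb_or => /andP[].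
- have [u' [c [e cT _ Hu' _]]] :=
    @simulates_call _ f (Update a a) (Hu01 (node_word a) (node_word a))
      (node_word_lt a) (node_word_lt a) erefl erefl.
  exists u', c.+1; split=> //.
  + rewrite -add1n; apply: ESeq (EMove w _ _ _) _.
    have -> // : set_reg (pass_args u (node_word a, node_word b)) 1 (node_word a)
         = set_reg (set_reg u 0 (node_word a)) 1 (node_word a).
    congr Machine; apply/funext => -[|[|i]] //.
  + have := exec_gt0 e; rewrite -(ler1n R) => c0.
    by rewrite -natr1; lra.
  apply: IH Hu' _; have Eab := Hdel _ _ erefl; split=> [v w'|v Hv]; rewrite ffunE.
    rewrite !inE xpair_eqE => /andP[nab vw'].
    case: eqP nab vw' => [->|_ _]; last exact: Hf.1.
    (* A remaining edge [(a, w')] would force [w' = f a = b], but [(a, b)] is the deleted edge. *)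
    by rewrite -(Hf.1 _ _ Eab) => /negP nw' /Hf.1 fw'; rewrite fw' eqxx in nw'.
  case: eqP => [->//|/eqP va].
  by apply: Hf.2 => w'; have := Hv w'; rewrite !inE xpair_eqE (negbTE va).
pose ua := pass_args u (node_word a, node_word b).
pose ub := set_reg (set_reg ua spare (node_word b)) 1 n.
have sp1 := spare_gt1.
have Hub : simulates ub f.
  apply: set_reg_simulates; [|lia|] => //.
  by apply: set_reg_simulates (Hu01 _ _); [rewrite leqnn orbT|lia].
have b0 : regs ub 0 = node_word a by do 2![rewrite set_reg_neq; last by lia].
have [u1 [c1 [e1 c1T ans1 Hu1 hu1]]] :=
  @simulates_call ub f (PointerQuery a n) Hub (node_word_lt a) nw b0 erefl.
pose uc := set_reg u1 spare.+2 (node_word (iter n f a)).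
pose ud := set_reg (set_reg uc 0 (node_word b)) 1 n.
have Hud : simulates ud f.
  apply: (pass_args_simulates (_, _)).
  by apply: set_reg_simulates Hu1; lia.
have [u2 [c2 [e2 c2T ans2 Hu2 hu2]]] :=
  @simulates_call ud f (PointerQuery b n) Hud (node_word_lt b) nw erefl erefl.
have un : regs u spare.+1 = n by case: Hu => s [].
exists (set_reg u2 0 (b \in component E a)),
  (1 + (1 + (c1 + (1 + (1 + (1 + (c2 + 1))))))).
split.
- have m1 := EMove w ua spare 1.
  have m2 := EMove w (set_reg ua spare (node_word b)) 1 spare.+1.
  rewrite !set_reg_neq ?un in m2; try lia.
  have m3 := EMove w u1 spare.+2 0; rewrite (ans1 _ erefl) in m3.
  have m4 := EMove w uc 0 spare.
  rewrite 1!set_reg_neq ?hu1 1?set_reg_neq ?set_reg_eq in m4; try lia.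
  have m5 := EMove w (set_reg uc 0 (node_word b)) 1 spare.+1.
  rewrite !set_reg_neq ?hu1 ?set_reg_neq ?un in m5; try lia.
  apply: ESeq m1 (ESeq m2 (ESeq e1 (ESeq m3 (ESeq m4 (ESeq m5 (ESeq e2 _)))))).
  have := EBinop w u2 BEq 0 0 spare.+2.
  rewrite (ans2 _ erefl) hu2; last by lia.
  rewrite set_reg_neq 1?set_reg_neq ?set_reg_eq; try lia.
  (* [BEq] reads the answer for [b] first, hence [eq_sym]. A query leaves [E] unchanged, so [HE]
     speaks of the current graph. *)
  rewrite /eval_binop /= eqSS val_eqE eq_sym -(connected_iterE a b HE Hf) ?card_ord //.
  (* The truth value fits in a word because the node [a] exists: [1 <= a.+1 < 2 ^ w]. *)
  rewrite modn_small //; apply: leq_ltn_trans (leq_ltn_trans (ltn_ord a) nw).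
  by case: (_ \in _).
- have := exec_gt0 e1; rewrite -(ler1n R) => c0.
  by rewrite !natrD; lra.
- by move=> y [<-].
- by apply: IH Hf; apply: set_reg_simulates => //; lia.
Qed.

End Reduction.

Theorem theorem4p2 (R : realType) (w : nat -> nat)
    (hw : forall n : nat, n < 2 ^ w n)
    (f0 : forall n : nat, {ffun 'I_n -> 'I_n})
    (t : nat -> R) :
  solvable_in_time (pointer_following f0) w t ->
  solvable_in_time path_connectivity w t.
Proof.
move=> [D [T [HD HT]]].
exists (path_structure D), (fun n => 8%:R * T n)%R; split.
  move=> n; have [s0 [c0 [e0 H0]]] := HD n.
  have [u [c [e Hu]]] := path_setup_correct (hw n) e0 H0.
  exists u, c; split=> // rs; apply: path_serves Hu _ => //.
  (* The initial graph has no edges, so the identity left by the preprocessing follows it. *)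
  split=> v; first by move=> w'; rewrite inE.
  by rewrite ffunE.
apply/eqO_exP; move/eqO_exP: HT => [k k0 Hk].
exists (8%:R * k)%R; first by rewrite mulr_gt0.
by apply: filterS Hk => n; rewrite normrM ger0_norm // -mulrA ler_pM2l.
Qed.
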